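(* Let $X$ be a metrizable compactum with $\dim X\le n$. Then $C(X,\mathbb{R}^{n+2})$ contains a dense $G_\delta$-subset of maps $g$ such that for any natural number $r\geq 1$ with $r\le n+2$ and any line $\Pi^1\subset\mathbb{R}^{n+2}$ parallel to some coordinate plane $\Pi^r$ in $\mathbb{R}^{n+2}$, the inverse image $g^{-1}(\Pi^1)$ has at most $n+r$ points.
   Context: $n\ge 0$ is an integer and $\dim$ is covering dimension. $C(X,\mathbb{R}^{n+2})$ is the space of continuous maps with the uniform convergence topology (which for compact $X$ coincides with the source limitation topology). A line is a $1$-dimensional affine subspace. A coordinate $r$-plane $\Pi^r$ is the linear span of $r$ of the standard unit coordinate vectors; a line is parallel to $\Pi^r$ if its direction space is contained in $\Pi^r$. *)

(* Defs.v *)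
From HB Require Import structures.
From mathcomp Require Import all_boot all_order all_algebra.
From mathcomp Require Import all_classical all_reals all_analysis.

Set Implicit Arguments.
Unset Strict Implicit.
Unset Printing Implicit Defensive.

Import GRing.Theory.
Local Open Scope classical_set_scope.
Local Open Scope card_scope.
Local Open Scope ring_scope.

Section CoveringDimension.
Variable X : topologicalType.
Implicit Types U V : set (set X).

Definition open_cover U : Prop :=
  (forall A, U A -> open A) /\ \bigcup_(A in U) A = [set: X].

Definition refines V U : Prop :=
  forall B, V B -> exists2 A, U A & B `<=` A.

(* Order at most n: any n + 2 distinct members have empty intersection,
   i.e. every point lies in at most n + 1 members. *)
Definition order_le n V : Prop :=
  forall x : X, [set B | V B /\ B x] #<= `I_n.+1.

(* dim X <= n for the Cech-Lebesgue covering dimension; the empty space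
   satisfies this for every n. *)
Definition covering_dim_le n : Prop :=
  forall U, finite_set U -> open_cover U ->
    exists V, [/\ finite_set V, open_cover V, refines V U & order_le n V].

End CoveringDimension.

Section Lines.
Variables (R : realType) (m : nat).

Definition affine_subspace (p : 'rV[R]_m) (D : {vspace 'rV[R]_m}) :
    set 'rV[R]_m :=
  [set x | x - p \in D].

Definition coordinate_plane (I : {set 'I_m}) : {vspace 'rV[R]_m} :=
  span [seq delta_mx 0 i | i <- enum I].

Definition is_coordinate_plane (r : nat) (P : {vspace 'rV[R]_m}) : Prop :=
  exists2 I : {set 'I_m}, #|I| = r & P = coordinate_plane I.

Definition is_line_with_direction (l : set 'rV[R]_m) (D : {vspace 'rV[R]_m})
    : Prop :=
  \dim D = 1%N /\ exists p, l = affine_subspace p D.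

Definition is_line (l : set 'rV[R]_m) : Prop :=
  exists D, is_line_with_direction l D.

Definition parallel_to (l : set 'rV[R]_m) (P : {vspace 'rV[R]_m}) : Prop :=
  exists2 D, is_line_with_direction l D & (D <= P)%VS.

End Lines.

(* Main.v *)
From HB Require Import structures.
Require Import Defs.
From mathcomp Require Import all_boot all_order all_algebra.
From mathcomp Require Import all_classical all_reals all_analysis.
From mathcomp Require Import borel_hierarchy.
From mathcomp Require Import ring lra zify.

Set Implicit Arguments.
Unset Strict Implicit.
Unset Printing Implicit Defensive.

Import Order.TTheory GRing.Theory Num.Theory.
Import numFieldNormedType.Exports.
(* puts the topology of uniform convergence on [continuousType X Y] *)
Import ArrowAsUniformType.

Local Open Scope ring_scope.

(** Fix a set [I] of coordinates, an index [i0] in [I] and [eps > 0].  A line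
    parallel to the plane spanned by [I] whose direction has its largest
    coordinate at [i0] can be written [y_i = a_i + d_i * y_i0] with [a_i0 = 0],
    [d_i0 = 1], [|d_i| <= 1] and [d_i = 0] off [I] ([line_normal_form]), so such
    lines depend on [(n + 1) + (#|I| - 1) = n + #|I|] bounded parameters.  Call
    a map [g] good when some [delta > 0] bounds from below the distance, in the
    sense of these equations, between every such line and the images of every
    [q = n + #|I| + 1] points that are pairwise [eps]-separated.  Stating
    goodness with a uniform [delta] makes it an open condition in [g] at once
    ([open_line_avoiding]).  Letting [I], [i0] and [eps = 1 / (m + 1)] vary
    gives countably many conditions, and a map satisfying all of them cannot
    send [q] distinct points into one line.  It remains to show that good maps
    are dense ([dense_line_avoiding]) and to apply a Baire argument, valid
    because continuous maps are closed under uniform limits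
    ([baire_relative]).

    For density, a given map is replaced by [g x = \sum_u w_u x *: p_u], where
    [w] is a partition of unity subordinate to a fine open cover of order at
    most [n] and [p_u] is close to the values of the map on the [u]-th member.
    If [x_1, .., x_q] are separated by more than the mesh of the cover, then the
    points [g x_j] lie in pairwise disjoint simplices, each with at most [n + 1]
    vertices.  So everything reduces to a statement about finite sets of points
    ([general_position]): after an arbitrarily small displacement, no line of
    the given kind comes within [delta] of [q] simplices with disjoint vertex
    sets of size at most [n + 1].

    This is proved by counting.  Let each coordinate of each vertex range over
    [m] equally spaced values, and cover the parameters of the lines by a net of
    [m ^ (q - 1)] lines whose errors are [O(1 / m)].  For a fixed line the
    vectors [p_u - a - d * p_u,i0] of one simplex live in a space of dimension
    [n + 1], and the line meets the simplex only when these at most [n + 1]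
    vectors have a convex combination equal to zero.  Then a vertex of largest
    weight lies, up to [O(1 / m)], in a hyperplane through the others, which
    happens for a proportion [O(1 / m)] of its positions
    ([card_near_incident]).  The [q] simplices involve different vertices, so
    the proportions multiply ([card_bigcap_fibers]): a given line of the net is
    close to [q] given simplices for a proportion [O(m ^ - q)] of the
    configurations.  Summing over the net leaves a proportion [O(1 / m)] of bad
    configurations, which is less than one for [m] large. *)

(** * Counting functions on a finite product *)

Definition update (V : finType) (T : Type) (f : {ffun V -> T}) (v : V) (t : T) :
    {ffun V -> T} :=
  [ffun u => if u == v then t else f u].

(** Exchanging the value at [v] with an external value is an involution of
    pairs, so resampling one coordinate preserves the counting measure. *)
Lemma card_update_fibers (V T : finType) (v : V) (S : {set {ffun V -> T}}) :
  (\sum_(f : {ffun V -> T}) #|[set t | update f v t \in S]| = #|S| * #|T|)%N.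
Proof.
pose swap (x : {ffun V -> T} * T) := (update x.1 v x.2, x.1 v).
have swapK : involutive swap.
  move=> [f t]; rewrite /swap /=; congr pair; last by rewrite ffunE eqxx.
  by apply/ffunP => u; rewrite !ffunE; case: eqP => // ->.
transitivity (\sum_(x : {ffun V -> T} * T) (update x.1 v x.2 \in S))%N.
  rewrite -(pair_bigA _ (fun f t => (update f v t \in S) : nat)) /=.
  apply: eq_bigr => f _; rewrite -sum1_card.
  by rewrite big_mkcond /=; apply: eq_bigr => t _; rewrite inE; case: (_ \in S).
rewrite (reindex_inj (inv_inj swapK)) /=.
under eq_bigr => x _ do rewrite -[update _ _ _]/((swap (swap x)).1) swapK.
rewrite -(pair_bigA _ (fun f (t : T) => (f \in S) : nat)) /=.
under eq_bigr => f _ do rewrite sum_nat_const.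
rewrite -big_distrr /= mulnC -[#|S|]sum1_card [in RHS]big_mkcond /=.
by congr (_ * _)%N; apply: eq_bigr => f _; case: (_ \in S).
Qed.

(** Independence of one event from another: [A] does not look at the coordinate
    [v], and along every line in that coordinate [E] has density at most
    [C / m]. *)
Lemma card_setI_fibers (V T : finType) (v : V) (A E : {set {ffun V -> T}})
    (m C : nat) :
  (forall f t, (update f v t \in A) = (f \in A)) ->
  (forall f, #|[set t | update f v t \in E]| * m <= C * #|T|)%N ->
  (#|E :&: A| * m <= C * #|A|)%N.
Proof.
move=> hA hE; have [T0|T0] := posnP #|T|.
  suff -> : E :&: A = finset.set0 by rewrite cards0.
  by apply/setP => f; move: (fintype.card0_eq T0 (f v)); rewrite inE.
rewrite -(leq_pmul2r T0) mulnAC -(card_update_fibers v) big_distrl /=.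
have -> : (C * #|A| * #|T| = \sum_(f in A) C * #|T|)%N.
  by rewrite sum_nat_const mulnA [(#|A| * C)%N]mulnC.
rewrite [leqRHS]big_mkcond /=; apply: leq_sum => f _.
case: ifP => fA.
  apply: leq_trans (hE f); rewrite leq_mul2r; apply/orP; right.
  by apply: subset_leq_card; apply/fintype.subsetP => t; rewrite !inE => /andP[].
rewrite (_ : finset _ = finset.set0) ?cards0 //.
by apply/setP => t; rewrite !inE hA fA andbF.
Qed.

(** A product bound for the density of an intersection.  The events need not be
    independent in the usual sense: it is enough that [E j'] ignores the
    coordinate [v j] along which the density of [E j] is controlled. *)
Lemma card_bigcap_fibers (V T J : finType) (v : J -> V)
    (E : J -> {set {ffun V -> T}}) (m C : nat) :
  (forall j j' f t, j != j' -> (update f (v j) t \in E j') = (f \in E j')) ->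
  (forall j f, #|[set t | update f (v j) t \in E j]| * m <= C * #|T|)%N ->
  (#|[set f | [forall j, f \in E j]]| * m ^ #|J| <=
     C ^ #|J| * #|{ffun V -> T}|)%N.
Proof.
move=> hE hC.
suff H s : uniq s -> (#|[set f | all (fun j => f \in E j) s]| * m ^ size s <=
     C ^ size s * #|{ffun V -> T}|)%N.
  have := H _ (enum_uniq J); rewrite -cardE; congr (_ * _ <= _)%N.
  apply: eq_card => f; rewrite !inE; apply/allP/forallP => [h j|h j _ //].
  by apply: h; rewrite mem_enum.
elim: s => [|j s IHs] /=; first by rewrite !muln1 mul1n max_card.
case/andP=> js us.
have -> : [set f | (f \in E j) && all (fun j => f \in E j) s] =
    E j :&: [set f | all (fun j => f \in E j) s].
  by apply/setP => f; rewrite !inE.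
rewrite !expnS mulnA.
apply: (@leq_trans (C * #|[set f | all (fun j => f \in E j) s]| * m ^ size s)).
  rewrite leq_mul2r; apply/orP; right.
  apply: (@card_setI_fibers _ _ (v j)) => [f t|f]; last exact: hC.
  rewrite !inE; apply: eq_in_all => k ks; apply: hE.
  by apply: contraNneq js => ->.
by rewrite -!mulnA leq_mul2l IHs ?orbT.
Qed.

Lemma card_window (m C : nat) (S : {set 'I_m}) :
  (forall k l : 'I_m, k \in S -> l \in S -> (l < k + C)%N) -> (#|S| <= C)%N.
Proof.
move=> hS; have [->|[k0 k0S]] := set_0Vmem S; first by rewrite cards0.
case: (arg_minnP (fun k : 'I_m => k : nat) k0S) => k kS kmin.
rewrite cardE -(size_map (@nat_of_ord m)) -[leqRHS](size_iota k).
apply: uniq_leq_size; first by rewrite map_inj_uniq ?enum_uniq //; exact: val_inj.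
move=> x /mapP[l]; rewrite mem_enum => lS ->.
by rewrite mem_iota kmin //= hS.
Qed.

(** * Grid vertices close to a fixed line *)

Lemma exists_orthogonal (R : fieldType) (N : nat) (s : seq 'rV[R]_N) :
  (size s < N)%N ->
  exists2 h : 'I_N -> R, (exists i, h i != 0) &
    forall u, u \in s -> \sum_i h i * u 0 i = 0.
Proof.
move=> sN; pose M := \matrix_(i < N, k < size s) s`_k 0 i.
have : kermx M != 0.
  rewrite -mxrank_eq0 mxrank_ker -lt0n subn_gt0.
  exact: leq_ltn_trans (rank_leq_col M) sN.
move=> /rowV0Pn[h hM h0]; exists (h 0).
  by have /rV0Pn[i hi] := h0; exists i.
move=> u us; have uk : (index u s < size s)%N by rewrite index_mem.
move/sub_kermxP: hM => /rowP/(_ (Ordinal uk)).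
rewrite !mxE => E; rewrite -[RHS]E.
by apply: eq_bigr => i _; rewrite mxE /= nth_index.
Qed.

(** Normalized equations [y_i = a_i + d_i * y_i0] of a line parallel to the
    coordinate plane of [I].  Dividing the direction by its coordinate of largest
    absolute value makes [d] range over a compact set. *)
Definition line_coef (R : realType) (N : nat) (I : {set 'I_N}) (i0 : 'I_N)
    (a d : 'I_N -> R) : Prop :=
  [/\ a i0 = 0, d i0 = 1, forall i, `|d i| <= 1 & forall i, i \notin I -> d i = 0].

Section GridCounting.
Variables (R : realType) (N : nat) (V : finType).
Variables (z : V -> 'I_N -> R) (eta : R) (m : nat).

Definition grid_point (f : {ffun V -> {ffun 'I_N -> 'I_m}}) (v : V) (i : 'I_N) : R :=
  z v i + eta / m%:R * (f v i)%:R.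

(** The configurations for which some combination of the defects
    [p_u - a - d * p_u,i0], for [u] in [S], is small.  A point of the simplex on
    [S] close to the line [(a, d)] provides one, once its weights are divided by
    the weight of [v]; the normalization [t v = 1] makes [v] the vertex whose
    position is constrained. *)
Definition near_incident (i0 : 'I_N) (a d : 'I_N -> R) (kappa : R) (S : {set V})
    (v : V) : {set {ffun V -> {ffun 'I_N -> 'I_m}}} :=
  [set f | `[< exists2 t : V -> R, t v = 1 &
     forall i, `|\sum_(u in S) t u *
        (grid_point f u i - a i - d i * grid_point f u i0)| <= kappa / m%:R >]].

Lemma near_incident_update i0 a d kappa (S : {set V}) v f u t : u \notin S ->
  (update f u t \in near_incident i0 a d kappa S v) =
  (f \in near_incident i0 a d kappa S v).
Proof.
move=> uS; rewrite !inE.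
have E (w : V -> R) i :
    \sum_(x in S) w x * (grid_point (update f u t) x i - a i
      - d i * grid_point (update f u t) x i0) =
    \sum_(x in S) w x * (grid_point f x i - a i - d i * grid_point f x i0).
  apply: eq_bigr => x xS; rewrite /grid_point !ffunE.
  by case: eqP => // xu; rewrite xu (negbTE uS) in xS.
by apply/asboolP/asboolP => -[w wv hw]; exists w => // i; have := hw i; rewrite E.
Qed.

(** With all vertices but [v] fixed, some [h] is orthogonal to the other columns
    and has no component along [i0], because these are at most [N - 1] linear
    conditions.  Pairing with [h] turns near incidence into a strip of width
    [O(1 / m)] for the position of [v], transverse to a coordinate [i1] where
    [h] is largest; each line in that coordinate meets the strip in at most [C]
    grid points. *)
Lemma card_near_incident i0 a d kappa (S : {set V}) v (C : nat) f :
  (0 < m)%N -> 0 < eta -> a i0 = 0 -> d i0 = 1 -> v \in S -> (#|S| < N)%N ->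
  2 * N%:R * kappa < eta * C%:R ->
  (#|[set t | update f v t \in near_incident i0 a d kappa S v]| * m <=
     C * #|{ffun 'I_N -> 'I_m}|)%N.
Proof.
move=> m0 eta0 ai0 di0 vS SN hC.
pose col (g : {ffun V -> {ffun 'I_N -> 'I_m}}) u i : R :=
  grid_point g u i - a i - d i * grid_point g u i0.
have coli0 g u : col g u i0 = 0 by rewrite /col ai0 di0 mul1r subr0 subrr.
(* the component along [i0] of every column vanishes, so it gives no
   information; the vector [delta_mx 0 i0] keeps [h] away from it *)
pose s := delta_mx 0 i0 ::
  [seq \row_i col f u i | u <- enum (S :\ v)].
have sN : (size s < N)%N.
  rewrite /= size_map -cardE.
  by apply: leq_ltn_trans SN; rewrite (cardsD1 v S) vS.
have [h0 [i2 h0i2] hs] := exists_orthogonal sN.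
have [i1 _ i1max] : exists2 i1, true & forall i, `|h0 i| <= `|h0 i1|.
  by case: (@arg_maxP _ _ _ i2 xpredT (fun i => `|h0 i|) isT) => i1 _ H;
     exists i1 => // i; apply: H.
have h01 : 0 < `|h0 i1| by apply: lt_le_trans (i1max i2); rewrite normr_gt0.
pose h i := h0 i / h0 i1.
have h1 : h i1 = 1 by rewrite /h divff // -normr_gt0.
have hle i : `|h i| <= 1 by rewrite /h normrM normfV ler_pdivrMr // mul1r.
have hi0 : h i0 = 0.
  have := hs (delta_mx 0 i0) (mem_head _ _).
  rewrite (bigD1 i0) //= mxE !eqxx mulr1 big1 ?addr0 => [|i ii0].
    by rewrite /h => ->; rewrite mul0r.
  by rewrite mxE (negbTE ii0) andbF mulr0.
have i10 : i1 != i0.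
  by apply: contra_eq_neq h1 => ->; rewrite hi0 eq_sym oner_eq0.
have hort u : u \in S -> u != v -> \sum_i h i * col f u i = 0.
  move=> uS uv; have := hs (\row_i col f u i).
  rewrite in_cons map_f ?orbT ?mem_enum ?in_setD1 ?uv //.
  move=> /(_ isT) /(congr1 ( *%R (h0 i1)^-1)).
  rewrite mulr0 => E; rewrite -[RHS]E mulr_sumr; apply: eq_bigr => i _.
  by rewrite mxE /h -mulrA mulrCA.
pose pt (t : {ffun 'I_N -> 'I_m}) i := z v i + eta / m%:R * (t i)%:R.
pose L (t : {ffun 'I_N -> 'I_m}) := \sum_i h i * (pt t i - a i - d i * pt t i0).
pose E := [set t | `|L t| <= N%:R * kappa / m%:R].
have subE : [set t | update f v t \in near_incident i0 a d kappa S v] \subset E.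
  apply/fintype.subsetP => t; rewrite inE [t \in E]inE inE asboolE => -[w wv hw].
  pose g := update f v t.
  have -> : L t = \sum_i h i * (\sum_(u in S) w u * col g u i).
    under [RHS]eq_bigr => i _ do rewrite mulr_sumr.
    rewrite exchange_big (bigD1 v) //= [X in _ + X]big1 => [|u /andP[uS uv]].
      rewrite addr0; apply: eq_bigr => i _; rewrite wv mul1r.
      by rewrite /col /grid_point /g ffunE eqxx.
    transitivity (w u * \sum_i h i * col f u i).
      rewrite mulr_sumr; apply: eq_bigr => i _; rewrite mulrCA.
      by rewrite /col /grid_point /g ffunE (negbTE uv).
    by rewrite hort ?mulr0.
  apply: le_trans (ler_norm_sum _ _ _) _.
  apply: (@le_trans _ _ (\sum_(i < N) kappa / m%:R)).
    apply: ler_sum => i _; rewrite normrM -[leRHS]mul1r.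
    by apply: ler_pM => //; exact: hw.
  by rewrite sumr_const card_ord -[leLHS]mulr_natl mulrA.
apply: (@leq_trans (#|E| * m)).
  by rewrite leq_mul2r subset_leq_card ?orbT.
have := @card_setI_fibers _ _ i1 [set: {ffun 'I_N -> 'I_m}] E m C.
rewrite finset.setIT cardsT; apply=> [|t]; first by move=> *; rewrite !inE.
rewrite card_ord leq_mul2r; apply/orP; right; apply: card_window => k l.
rewrite !inE => hk hl; rewrite -(ltr_nat R) natrD -ltrBlDl.
have m0R : 0 < m%:R :> R by rewrite ltr0n.
have Ldiff : L (update t i1 l) - L (update t i1 k) = eta / m%:R * (l%:R - k%:R).
  rewrite /L -sumrB (bigD1 i1) //= [X in _ + X]big1 => [|i ii1].
    rewrite addr0 h1 /pt !ffunE eqxx (eq_sym i0) (negbTE i10); ring.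
  rewrite /pt !ffunE (negbTE ii1) (eq_sym i0) (negbTE i10); ring.
have : eta / m%:R * (l%:R - k%:R) <= 2 * (N%:R * kappa / m%:R).
  rewrite -Ldiff mulr_natl mulr2n; apply: le_trans (ler_norm _) _.
  by apply: le_trans (ler_normB _ _) _; exact: lerD.
rewrite mulrAC ler_pdivrMr // -!mulrA mulVf ?gt_eqF // mulr1 => H.
rewrite -(ltr_pM2l eta0); apply: le_lt_trans H _.
by rewrite mulrA.
Qed.

End GridCounting.

(** * A finite net of lines *)

(** The union bound, in the same density form as above. *)
Lemma card_exists_le (T K : finType) (D : {set K}) (F : K -> {set T})
    (m c : nat) :
  (forall k, k \in D -> #|F k| * m <= c)%N ->
  (#|[set x | [exists k in D, x \in F k]]| * m <= #|D| * c)%N.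
Proof.
move=> hF; rewrite -[leqRHS]sum_nat_const.
apply: (@leq_trans ((\sum_(k in D) #|F k|) * m)); last first.
  by rewrite big_distrl /=; apply: leq_sum.
rewrite leq_mul2r; apply/orP; right.
have -> : (\sum_(k in D) #|F k| = \sum_x \sum_(k in D) (x \in F k))%N.
  rewrite exchange_big /=; apply: eq_bigr => k _.
  by rewrite -sum1_card big_mkcond; apply: eq_bigr => x _; case: (_ \in _).
rewrite -sum1_card big_mkcond /=; apply: leq_sum => x _.
rewrite inE; case: ifP => // /existsP[k /andP[kD xk]].
by rewrite (bigD1 k) //= xk.
Qed.

Lemma grid_approx (R : realType) (m : nat) (A x : R) :
  `|x| < A -> exists k : 'I_m.+1,
    `|x - (2 * A / m.+1%:R * k%:R - A)| <= 2 * A / m.+1%:R.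
Proof.
move=> xA; have A0 : 0 < A by apply: le_lt_trans xA.
have M0 : 0 < m.+1%:R :> R by rewrite ltr0n.
pose s := 2 * A / m.+1%:R; have s0 : 0 < s by rewrite divr_gt0 ?mulr_gt0.
have /ltr_normlP[xA1 xA2] := xA.
have y0 : 0 <= (x + A) / s by rewrite divr_ge0 ?(ltW s0) //; lra.
have kM : (Num.truncn ((x + A) / s) < m.+1)%N.
  rewrite truncn_lt_nat // ltr_pdivrMr // /s mulrC divfK ?gt_eqF //; lra.
exists (Ordinal kM) => /=; rewrite -/s; set k := Num.truncn _.
have /andP[] := truncn_itv y0; rewrite -/k ler_pdivlMr // ltr_pdivrMr //.
rewrite -natr1 mulrDl mul1r (mulrC _ s) => h1 h2.
by rewrite ler_norml; apply/andP; split; lra.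
Qed.

Lemma convex_sum_le (R : numDomainType) (V : finType) (w y : V -> R) (B : R) :
  (forall u, 0 <= w u) -> \sum_u w u = 1 -> (forall u, `|y u| <= B) ->
  `|\sum_u w u * y u| <= B.
Proof.
move=> w0 w1 yB; apply: le_trans (ler_norm_sum _ _ _) _.
rewrite -[leRHS]mul1r -w1 mulr_suml; apply: ler_sum => u _.
by rewrite normrM ger0_norm // ler_wpM2l.
Qed.

Lemma large_weight (R : realDomainType) (V : finType) (N : nat) (w : V -> R) :
  (forall u, 0 <= w u) -> \sum_u w u = 1 -> (#|[set u | w u != 0%R]| <= N)%N ->
  exists v, 1 <= N%:R * w v.
Proof.
move=> w0 w1 wN; have [v0 _|V0] := pickP V; last first.
  by move: w1; rewrite big_pred0 // => /esym/eqP; rewrite oner_eq0.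
case: (@arg_maxP _ _ _ v0 xpredT w isT) => v _ wv; exists v.
rewrite -[leLHS]w1 (bigID (fun u => w u != 0)) /= [X in _ + X]big1 => [|u].
  rewrite addr0; apply: (@le_trans _ _ (\sum_(u | w u != 0) w v)).
    by apply: ler_sum => u _; exact: wv.
  rewrite sumr_const -[leLHS]mulr_natl; apply: ler_wpM2r => //.
  by rewrite ler_nat; apply: leq_trans wN; rewrite cardsE.
by rewrite negbK => /eqP.
Qed.

(** A net of the normalized equations with coefficients in a grid of mesh
    [2 * A / m.+1] of the interval [[-A, A)].  Only the [N - 1] coefficients
    [a_i] with [i != i0] and the [#|I| - 1] coefficients [d_i] with [i] in [I],
    [i != i0], are free; the others are coded by [ord0] so that the net has
    exactly the right cardinality. *)
Section LineNet.
Variables (R : realType) (N m : nat) (A : R) (I : {set 'I_N}) (i0 : 'I_N).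
Implicit Types (k : {ffun 'I_N -> 'I_m.+1}).

Let grid (l : 'I_m.+1) : R := 2 * A / m.+1%:R * l%:R - A.

Definition net_a k i : R := if i == i0 then 0 else grid (k i).
Definition net_d k i : R :=
  if i == i0 then 1 else if i \in I then grid (k i) else 0.

Definition line_net : {set {ffun 'I_N -> 'I_m.+1} * {ffun 'I_N -> 'I_m.+1}} :=
  finset.setX [set k | k \in pffun_on ord0 [set~ i0] predT]
    [set k | k \in pffun_on ord0 (I :\ i0) predT].

Lemma card_line_net q : i0 \in I -> q.+1 = (N + #|I|)%N ->
  (#|line_net| * m.+1 = m.+1 ^ q)%N.
Proof.
move=> i0I qE; rewrite cardsX !cardsE !card_pffun_on.
rewrite (_ : #|predT| = m.+1); last by rewrite -[RHS]card_ord; apply: eq_card.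
rewrite -expnD -expnSr; congr (_ ^ _)%N; apply: succn_inj; rewrite qE.
rewrite (cardsD1 i0 I) i0I cardsC1 card_ord.
by move: #|_| (ltn_ord i0) => c /=; lia.
Qed.

Lemma line_netP (a d : 'I_N -> R) :
  line_coef I i0 a d -> 1 < A -> (forall i, `|a i| < A) ->
  exists c, [/\ c \in line_net,
    forall i, `|a i - net_a c.1 i| <= 2 * A / m.+1%:R &
    forall i, `|d i - net_d c.2 i| <= 2 * A / m.+1%:R].
Proof.
move=> [a0 d0 d1 dI] A1 aA.
have e0 : 0 <= 2 * A / m.+1%:R by rewrite divr_ge0 //; lra.
have /choice[ka hka] : forall i, exists l,
    `|a i - grid l| <= 2 * A / m.+1%:R.
  by move=> i; exact: grid_approx.
have /choice[kd hkd] : forall i, exists l,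
    `|d i - grid l| <= 2 * A / m.+1%:R.
  by move=> i; apply: grid_approx; exact: le_lt_trans (d1 i) _.
pose ka' := [ffun i => if i == i0 then ord0 else ka i].
pose kd' := [ffun i => if i \in I :\ i0 then kd i else ord0].
exists (ka', kd'); split => [|i|i].
- rewrite finset.in_setX !inE /=; apply/andP; split; apply/pffun_onP; split => //.
    by apply/fintype.subsetP => i; rewrite !inE ffunE; case: (i == i0); rewrite ?eqxx.
  by apply/fintype.subsetP => i; rewrite inE ffunE; case: ifP => //; rewrite eqxx.
- rewrite -[(ka', kd').1]/ka' /net_a ffunE.
  by have [->|_] := eqVneq i i0; rewrite ?a0 ?subrr ?normr0.
- rewrite -[(ka', kd').2]/kd' /net_d ffunE in_setD1.
  have [->|_] := eqVneq i i0; first by rewrite d0 subrr normr0.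
  rewrite /=; have [iI|iI] := boolP (i \in I); first exact: hkd.
  by rewrite dI // subrr normr0.
Qed.

End LineNet.

(** * Vertices in general position *)

(** Barycentric coordinates of points, one for each [j], in simplices with at
    most [s] vertices and pairwise disjoint vertex sets. *)
Record nerve_weights (R : realType) (V : finType) (J : finType) (s : nat)
    (w : J -> V -> R) : Prop := NerveWeights {
  weights_ge0 : forall j u, 0 <= w j u;
  weights_sum1 : forall j, \sum_u w j u = 1;
  weights_card : forall j, (#|[set u | w j u != 0%R]| <= s)%N;
  weights_disjoint : forall j j' u, j != j' -> w j u != 0 -> w j' u = 0
}.

Section GeneralPosition.
Variables (R : realType) (N : nat) (V : finType) (z : V -> 'I_N -> R) (eta : R).
Variables (I : {set 'I_N}) (i0 : 'I_N) (q : nat).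
Hypotheses (eta0 : 0 < eta) (i0I : i0 \in I) (qE : q.+1 = (N + #|I|)%N).

Let index : finType := {ffun 'I_q -> {set V} * V}.
(** [bound] dominates every coordinate of a displaced vertex, [width] every
   coefficient of a line passing close to such points, and [kappa / m.+1] the
   error made by replacing a line by one of the net, multiplied by [N] when the
   largest weight is normalized to one. *)
Let bound : R := \sum_v \sum_i `|z v i| + eta.
Let width : R := 2 * bound + 2.
Let kappa : R := N%:R * (1 + 2 * width * (1 + bound)).

Let bound_ge0 : 0 <= bound.
Proof.
by apply: addr_ge0 (ltW eta0); apply: sumr_ge0 => v _; apply: sumr_ge0.
Qed.

(** Disjointness of the faces is only kept in the form needed to multiply
    densities: the marked vertex of a face belongs to no other face. *)
Definition marked_faces : {set index} :=
  [set s : index | [forall j : 'I_q, ((s j).2 \in (s j).1) && (#|(s j).1| < N)%N] &&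
     [forall j : 'I_q, forall j' : 'I_q, (j != j') ==> ((s j).2 \notin (s j').1)]].

Let bad m (k : ({ffun 'I_N -> 'I_m.+1} * {ffun 'I_N -> 'I_m.+1}) * index) :=
  [set f | [forall j, f \in near_incident z eta m.+1 i0 (net_a width i0 k.1.1)
    (net_d width I i0 k.1.2) kappa (k.2 j).1 (k.2 j).2]].

Let card_bad m C k : k.2 \in marked_faces ->
  2 * N%:R * kappa < eta * C%:R ->
  (#|bad (m := m) k| * m.+1 ^ q <= C ^ q * #|{ffun V -> {ffun 'I_N -> 'I_m.+1}}|)%N.
Proof.
rewrite inE => /andP[/forallP h1 /forallP h2] hC.
have := @card_bigcap_fibers V {ffun 'I_N -> 'I_m.+1} 'I_q (fun j => (k.2 j).2)
  (fun j => near_incident z eta m.+1 i0 (net_a width i0 k.1.1)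
    (net_d width I i0 k.1.2) kappa (k.2 j).1 (k.2 j).2) m.+1 C.
rewrite card_ord; apply => [j j' f t jj'|j f].
  by apply: near_incident_update; have /forallP/(_ j')/implyP := h2 j; apply.
have /andP[vS SN] := h1 j.
by apply: card_near_incident => //; rewrite /net_a /net_d eqxx.
Qed.

(** For each line of the net and each choice of faces the bad configurations have
   density at most [(C / m.+1) ^ q]; there are [m.+1 ^ (q - 1)] lines and a
   number of choices that does not depend on [m]. *)
Let exists_good : exists m (f : {ffun V -> {ffun 'I_N -> 'I_m.+1}}),
  forall k, k.1 \in line_net m I i0 -> k.2 \in marked_faces -> f \notin bad k.
Proof.
have [C hC] : exists C : nat, 2 * N%:R * kappa < eta * C%:R.
  exists (Num.truncn (2 * N%:R * kappa / eta)).+1.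
  by rewrite [ltRHS]mulrC -ltr_pdivrMr // truncnS_gt.
pose m := (#|index| * C ^ q)%N; exists m.
pose tot := #|{ffun V -> {ffun 'I_N -> 'I_m.+1}}|.
have tot0 : (0 < tot)%N by apply/card_gt0P; exists [ffun=> [ffun=> ord0]].
pose D := finset.setX (line_net m I i0) marked_faces.
have q0 : (0 < q)%N.
  move: qE; rewrite (cardsD1 i0) i0I.
  by move: #|_| (ltn_ord i0) => c /=; lia.
have H : (#|[set f | [exists k in D, f \in bad k]]| * m.+1 ^ q <=
    #|D| * (C ^ q * tot))%N.
  apply: card_exists_le => -[k k']; rewrite finset.in_setX => /andP[_ k2].
  exact: card_bad.
have [f fgood] : exists f, f \notin [set f | [exists k in D, f \in bad k]].
  apply/existsP; rewrite -negb_forall; apply/negP => /forallP allbad.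
  move: H; rewrite (eq_card (B := predT)) => [|f]; last by rewrite [LHS]allbad.
  rewrite -[#|predT|]/tot cardsX -(card_line_net m i0I qE).
  apply/negP; rewrite -ltnNge.
  set L := #|line_net m I i0|; set F := #|marked_faces|.
  have L0 : (0 < L)%N.
    have := card_line_net m i0I qE; rewrite -/L; case: L => // /esym/eqP.
    by rewrite mul0n expn_eq0.
  have FN : (F * C ^ q < m.+1)%N by rewrite ltnS leq_mul2r max_card orbT.
  have -> : (L * F * (C ^ q * tot) = (tot * L) * (F * C ^ q))%N by ring.
  by rewrite [ltnRHS]mulnA ltn_pmul2l // muln_gt0 tot0.
exists f => -[k k'] k1 k2; apply: contraNN fgood => fk; rewrite inE.
by apply/existsP; exists (k, k'); rewrite finset.in_setX k1 k2 fk.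
Qed.

(** The count of parameters: the lines form a family of dimension
    [N - 2 + #|I| = q - 1], while meeting each of the [q] disjoint faces imposes
    one condition.  The lower bound [delta] comes for free since the counting
    tolerates errors of order [1 / m]. *)
Lemma general_position : exists (p : V -> 'I_N -> R) (delta : R),
  [/\ forall v i, `|p v i - z v i| <= eta, 0 < delta &
    forall w : 'I_q -> V -> R, nerve_weights N.-1 w ->
    forall a d : 'I_N -> R, line_coef I i0 a d ->
    exists j i, delta <=
      `|\sum_v w j v * p v i - a i - d i * \sum_v w j v * p v i0|].
Proof.
have [m [f fgood]] := exists_good.
have M0 : 0 < m.+1%:R :> R by rewrite ltr0n.
pose p := grid_point z eta f.
have pz v i : `|p v i - z v i| <= eta.
  rewrite /p /grid_point addrAC subrr add0r ger0_norm; last first.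
    by rewrite mulr_ge0 ?ler0n // divr_ge0 ?ler0n // ltW.
  rewrite mulrAC ler_pdivrMr // ler_wpM2l ?(ltW eta0) // ler_nat.
  exact/ltnW.
have pB v i : `|p v i| <= bound.
  rewrite -(subrK (z v i) (p v i)) addrC; apply: le_trans (ler_normD _ _) _.
  apply: lerD (pz v i); rewrite (bigD1 v) //= (bigD1 i) //=.
  rewrite -addrA lerDl addr_ge0 ?sumr_ge0 // => v' _; exact: sumr_ge0.
exists p, m.+1%:R^-1; split; rewrite ?invr_gt0 // => w [w0 w1 wN wD] a d had.
apply: contrapT => /forallNP H.
have {}H j i : `|\sum_v w j v * p v i - a i - d i * \sum_v w j v * p v i0|
    < m.+1%:R^-1.
  by rewrite ltNge; apply/negP => h; apply: (H j); exists i.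
have yB j i : `|\sum_v w j v * p v i| <= bound by apply: convex_sum_le.
have [ai0 di0 d1 dI] := had.
have q0 : (0 < q)%N.
  move: qE; rewrite (cardsD1 i0) i0I.
  by move: #|_| (ltn_ord i0) => c /=; lia.
have aB i : `|a i| < width.
  have := H (Ordinal q0) i; have := yB (Ordinal q0) i; have := yB (Ordinal q0) i0.
  set y := \sum_v _; set y' := \sum_v _ => h1 h2 h3.
  have -> : a i = y' - d i * y - (y' - a i - d i * y) by ring.
  apply: le_lt_trans (ler_normB _ _) _.
  have dy : `|d i * y| <= bound.
    by rewrite normrM -[bound]mul1r; apply: ler_pM.
  have M1 : m.+1%:R^-1 <= 1 :> R by rewrite invf_le1 // ler1n.
  have h4 := ler_normB y' (d i * y).
  have : `|y' - d i * y| + `|y' - a i - d i * y| < (bound + bound) + 1.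
    apply: ler_ltD; last exact: lt_le_trans h3 M1.
    by apply: le_trans h4 _; exact: lerD.
  rewrite /width; lra.
have w1B : 1 < width by rewrite /width; move: bound_ge0; lra.
have [c [cnet ca cd]] := line_netP m had w1B aB.
have /choice[v hv] : forall j, exists v, 1 <= N%:R * w j v.
  by move=> j; apply: large_weight => //; exact: leq_trans (wN j) (leq_pred _).
have wv0 j : 0 < w j (v j).
  rewrite lt_neqAle w0 andbT; apply/eqP => E.
  by have := hv j; rewrite -E mulr0 ler10.
(* the faces are the supports of the weights, marked at a vertex of weight at
   least [1 / N] *)
pose s : index := [ffun j => ([set u | w j u != 0%R], v j)].
have sD : s \in marked_faces.
  rewrite inE; apply/andP; split.
    apply/forallP => j; rewrite ffunE /= inE gt_eqF //=.
    by apply: leq_ltn_trans (wN j) _; move: (ltn_ord i0); lia.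
  apply/forallP => j; apply/forallP => j'; apply/implyP => jj'.
  by rewrite !ffunE /= inE negbK (wD _ _ _ jj') // gt_eqF.
have := fgood (c, s) cnet sD; apply/negP; rewrite negbK inE.
apply/forallP => j; rewrite /= ffunE inE; apply/asboolP.
exists (fun u => w j u / w j (v j)); first by rewrite divff // gt_eqF.
move=> i; set a' := net_a _ _ _ _; set d' := net_d _ _ _ _ _.
set y := fun i => \sum_v w j v * p v i.
have -> : \sum_(u in [set u | w j u != 0]) w j u / w j (v j) *
    (p u i - a' - d' * p u i0) = (y i - a' - d' * y i0) / w j (v j).
  transitivity (\sum_u w j u / w j (v j) * (p u i - a' - d' * p u i0)).
    rewrite [RHS](bigID (mem [set u | w j u != 0])) /= [X in _ + X]big1 ?addr0 //.
    by move=> u; rewrite inE negbK => /eqP ->; rewrite !mul0r.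
  rewrite -[a' in RHS]mulr1 -(w1 j) /y !mulr_sumr -!sumrB mulr_suml.
  by apply: eq_bigr => u _; ring.
rewrite normrM normfV (gtr0_norm (wv0 j)) ler_pdivrMr //.
have num : `|y i - a' - d' * y i0| <= (1 + 2 * width * (1 + bound)) / m.+1%:R.
  have -> : y i - a' - d' * y i0 =
      (y i - a i - d i * y i0) + (a i - a') + (d i - d') * y i0 by ring.
  have -> : (1 + 2 * width * (1 + bound)) / m.+1%:R =
      m.+1%:R^-1 + 2 * width / m.+1%:R + 2 * width / m.+1%:R * bound by ring.
  apply: le_trans (ler_normD _ _) _; apply: lerD.
    apply: le_trans (ler_normD _ _) _; apply: lerD; first exact: ltW (H j i).
    exact: ca.
  rewrite normrM; by apply: ler_pM => //; exact: yB.
apply: le_trans num _; rewrite /kappa.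
set e := 1 + 2 * width * _; have e0 : 0 <= e.
  apply: addr_ge0 => //; apply: mulr_ge0; last exact: addr_ge0 bound_ge0.
  by apply: mulr_ge0 => //; exact: ltW (lt_trans ltr01 w1B).
have -> : N%:R * e / m.+1%:R * w j (v j) = e / m.+1%:R * (N%:R * w j (v j)) by ring.
by rewrite -[leLHS]mulr1 ler_wpM2l // divr_ge0.
Qed.

End GeneralPosition.

(** * Baire category, open covers and cardinality *)

Local Open Scope classical_set_scope.
Local Open Scope card_scope.
Local Open Scope ring_scope.

(** Baire's theorem for a sequentially closed subset [C] of a complete
    pseudometric space, with a point of the intersection found close to a given
    point of [C]. *)
Lemma baire_relative (R : realType) (T : pseudoMetricType R) (C : set T)
    (O : nat -> set T) :
  (forall F : set_system T, ProperFilter F -> cauchy F -> exists l : T, F --> l) ->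
  (forall (u : nat -> T) l, (forall k, C (u k)) -> u @ \oo --> l -> C l) ->
  (forall k, open (O k)) ->
  (forall k f e, C f -> 0 < e -> exists2 g, C g /\ O k g & ball f e g) ->
  forall f e, C f -> 0 < e ->
    exists2 g, C g /\ (forall k, O k g) & ball f e g.
Proof.
move=> Tcomplete Cclosed Oopen Odense f e Cf e0.
(* A state is a centre and a radius.  Limits of the centres are only controlled
   up to twice the radius, so it is the ball of doubled radius that has to lie in
   [O k]. *)
pose refine k (s t : T * R) := C s.1 -> 0 < s.2 ->
  [/\ C t.1, 0 < t.2, t.2 <= s.2 / 2, ball s.1 (s.2 / 2) t.1 &
      ball t.1 (t.2 + t.2) `<=` O k].
have step (ks : nat * (T * R)) : exists t, refine ks.1 ks.2 t.
  case: ks => k [g r]; have [[/= Cg r0]|nC] := pselect (C g /\ 0 < r); last first.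
    by exists (g, r) => Cg r0; case: nC.
  have r20 : 0 < r / 2 by rewrite divr_gt0.
  have [h [Ch Oh] gh] := Odense k g (r / 2) Cg r20.
  have : nbhs h (O k) by apply: open_nbhs_nbhs; split.
  rewrite -nbhs_ballE => -[d /= d0 dO].
  have m0 : 0 < Num.min (d / 2) (r / 2) by rewrite lt_min r20 divr_gt0.
  exists (h, Num.min (d / 2) (r / 2)) => _ _; split => //=.
    by rewrite ge_min lexx orbT.
  apply: subset_trans dO; apply: le_ball; rewrite [leRHS]splitr.
  by apply: lerD; rewrite ge_min lexx.
have [nxt nxtP] := choice step.
pose fix s k := if k is k'.+1 then nxt (k', s k') else (f, e / 2).
have e20 : 0 < e / 2 by rewrite divr_gt0.
have sC k : C (s k).1 /\ 0 < (s k).2.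
  by elim: k => // k [Ck rk]; have [] := nxtP (k, s k) Ck rk.
have sS k : [/\ (s k.+1).2 <= (s k).2 / 2, ball (s k).1 ((s k).2 / 2) (s k.+1).1 &
    ball (s k.+1).1 ((s k.+1).2 + (s k.+1).2) `<=` O k].
  by have [Ck rk] := sC k; have [] := nxtP (k, s k) Ck rk.
have nested k j x : ball (s (k + j)%N).1 (s (k + j)%N).2 x -> ball (s k).1 (s k).2 x.
  elim: j => [|j IHj]; first by rewrite addn0.
  rewrite addnS => hx; apply: IHj; have [h1 h2 _] := sS (k + j)%N.
  rewrite [(s (k + j)%N).2]splitr; apply: ball_triangle h2 _.
  exact: le_ball h1 _ hx.
have near_s k j : ball (s k).1 (s k).2 (s (k + j)%N).1.
  by apply: (nested k j); apply: ballxx; have [] := sC (k + j)%N.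
have radius d : 0 < d -> exists k, (s k).2 <= d.
  move=> d0; have r2 k : (s k).2 <= e / 2 ^+ k.
    elim: k => [|k IHk].
      by rewrite expr0 divr1 /= ler_pdivrMr // ler_peMr ?ler1n // ltW.
    have [h1 _ _] := sS k; apply: le_trans h1 _.
    by rewrite exprSr invfM mulrA ler_pM2r.
  exists (Num.truncn (e / d)); set k := Num.truncn _; apply: le_trans (r2 k) _.
  rewrite ler_pdivrMr ?exprn_gt0 // mulrC -ler_pdivrMr //.
  have /ltW h : e / d < k.+1%:R by rewrite truncnS_gt.
  apply: le_trans h _; rewrite -natrX ler_nat; exact: ltn_expl.
have [l sl] : exists l : T, (fun k => (s k).1) @ \oo --> l.
  apply: Tcomplete; apply: cauchy_exP => d d0.
  have [k kd] := radius d d0; exists (s k).1, k => // j /= kj.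
  by rewrite -(subnKC kj); apply: le_ball kd _ (near_s _ _).
have limit k : ball (s k).1 ((s k).2 + (s k).2) l.
  have [_ rk] := sC k.
  have : \forall j \near \oo, ball l (s k).2 (s j).1.
    by apply: sl; exact: nbhsx_ballx.
  case=> j0 _ hj; have := hj (k + j0)%N (leq_addl _ _) => /= /ball_sym.
  exact: ball_triangle.
have fl := limit 0%N; rewrite /= -splitr in fl; exists l => //.
split; first by apply: (Cclosed _ _ _ sl) => k; have [] := sC k.
by move=> k; have [_ _] := sS k; apply; exact: limit.
Qed.

(** Covering compactness without assuming that the space has a point. *)
Lemma compact_finite_subcover (T : topologicalType) (W : T -> set T) :
  compact [set: T] -> (forall x, open (W x)) -> (forall x, W x x) ->
  exists s : seq T, forall y, exists2 x, x \in s & W x y.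
Proof.
move=> cT oW Wx; have [[x0 _]|nT] := pselect (exists x : T, True); last first.
  by exists [::] => y; case: nT; exists y.
pose P : ptopologicalType := HB.pack T (isPointed.Build T x0).
have : cover_compact (T := P) setT by rewrite -compact_cover.
move=> /(_ P setT W (fun x _ => oW x)) [x _|D _ DT]; first by exists x.
by exists (finmap.enum_fset D) => y; have [x xD Wxy] := DT y I; exists x.
Qed.

(** The distance to the complement, or [1] when the complement is empty and that
    distance is infinite. *)
Lemma continuous_gauge (R : realType) (T : metricType R) (U : set T) :
  open U -> exists phi : T -> R,
    [/\ continuous phi, forall x, 0 <= phi x & forall x, 0 < phi x <-> U x].
Proof.
move=> oU; have [U0|/set0P[a Ua]] := eqVneq (~` U) set0.
  exists (fun=> 1); split=> // x; first exact: cvg_cst.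
  by split=> // _; apply: contrapT => nU; have : (~` U) x by []; rewrite U0.
pose D := @edist_inf R T (~` U).
have Dfin x : D x \is a fin_num.
  rewrite ge0_fin_numE ?edist_inf_ge0 //.
  apply: (@le_lt_trans _ _ (edist (x, a))).
    by apply: ereal_inf_lbound; exists a.
  rewrite -ge0_fin_numE ?edist_ge0 //; apply/edist_finP => /=.
  exists (mdist x a + 1); first by rewrite ltr_wpDl ?mdist_ge0.
  by rewrite ballEmdist /= ltrDl.
exists (fun x => fine (D x)); split=> [x|x|x].
- apply: fine_cvg; rewrite fineK //; exact: edist_inf_continuous.
- by rewrite fine_ge0 ?edist_inf_ge0.
- rewrite -lte_fin fineK //; split=> [|Ux].
    by apply: contraPP => nU; rewrite /D edist_inf0 // ltxx.
  have : nbhs x U by apply: open_nbhs_nbhs; split.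
  rewrite -nbhs_ballE => -[r /= r0 rU].
  apply: (@lt_le_trans _ _ r%:E); first by rewrite lte_fin.
  apply: le_ereal_inf_tmp => _ [b nUb <-]; rewrite leNgt; apply/negP.
  by move=> /edist_lt_ball /= /rU.
Qed.

Lemma uniq_card_le (T : eqType) (A : set T) (k : nat) (s : seq T) :
  uniq s -> (forall x, x \in s -> A x) -> A #<= `I_k -> (size s <= k)%N.
Proof.
move=> us sA /pcard_leP[f]; rewrite -(size_map f) -[leqRHS](size_iota 0 k).
apply: uniq_leq_size => [|_ /mapP[x /sA Ax ->]].
  rewrite map_inj_in_uniq // => x y /sA Ax /sA Ay.
  by apply: inj; exact: mem_set.
by rewrite mem_iota; have := @funS _ _ _ _ f _ Ax.
Qed.

Lemma card_gt_points (T : Type) (A : set T) (k : nat) :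
  ~ (A #<= `I_k) -> exists f : 'I_k.+1 -> T, injective f /\ forall i, A (f i).
Proof.
move=> nA; have : [set: 'I_k.+1] #<= A.
  rewrite -(card_le_eql (@card_II k.+1)).
  have [/finite_setP[m Am]|/infiniteP] := pselect (finite_set A); last first.
    by apply: card_le_trans; exact: subset_card_le.
  rewrite (card_le_eqr Am) card_le_II ltnNge.
  by apply/negP => mk; apply: nA; rewrite (card_le_eql Am) card_le_II.
move=> /card_leP[f].
exists (fun i => set_val (f (SigSub (mem_set (I : [set: 'I_k.+1] i))))); split.
  by move=> i j /val_inj /(@inj _ _ _ f) h; have [] := h (in_setT _) (in_setT _).
by move=> i; exact: set_valP.
Qed.
(** Members that are small both in [X] and in the image under [f]: refine by the
    dimension hypothesis a finite cover by traces of balls.  Indexing the members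
    by an ordinal without repetition turns the order of the cover into a bound
    on the number of indices. *)
Lemma exists_fine_cover (R : realType) (X : metricType R) (Y : pseudoMetricType R)
    (n : nat) (f : X -> Y) (e : R) :
  compact [set: X] -> covering_dim_le X n -> continuous f -> 0 < e ->
  exists (N : nat) (U : 'I_N -> set X),
    [/\ forall i, open (U i), forall x, exists i, U i x,
        forall i x y, U i x -> U i y -> ball x e y /\ ball (f x) e (f y) &
        forall x, (#|[set i | `[< U i x >]]%SET| <= n.+1)%N].
Proof.
move=> cX dX fc e0; have e20 : 0 < e / 2 by rewrite divr_gt0.
pose W x := (ball x (e / 2) `&` f @^-1` ball (f x) (e / 2))^°.
have Wx x : W x x.
  apply: filterI; first exact: nbhsx_ballx.
  by apply: fc; exact: nbhsx_ballx.
have [s sP] := compact_finite_subcover cX (fun x => @open_interior _ _) Wx.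
have [||V [Vfin [Vo Vc] Vr Vord]] := dX [set W x | x in [set` s]].
- by apply: finite_image; exact: finite_seq.
- split=> [A [x _ <-]|]; first exact: open_interior.
  apply/seteqP; split => // y _; have [x xs Wxy] := sP y.
  by exists (W x) => //; exists x.
have /finite_seqP[t0 tV] := Vfin; pose t := undup t0.
have tP A : A \in t <-> V A by rewrite mem_undup tV.
exists (size t), (fun i => nth set0 t i).
have Vt (i : 'I_(size t)) : V (nth set0 t i) by apply/tP; exact: mem_nth.
split=> [i|x|i x y Ux Uy|x].
- exact/Vo/Vt.
- have : [set: X] x by []. rewrite -Vc => -[A /tP At Ax].
  have it : (index A t < size t)%N by rewrite index_mem.
  by exists (Ordinal it); rewrite /= nth_index.
- have [_ [z _ <-] sub] := Vr _ (Vt i).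
  have /interior_subset[/= zx fzx] := sub _ Ux.
  have /interior_subset[/= zy fzy] := sub _ Uy.
  rewrite [e]splitr; split; last exact: ball_triangle (ball_sym fzx) fzy.
  exact: ball_triangle (ball_sym zx) zy.
- set S := (X in #|X|).
  rewrite cardE -(size_map (fun i : 'I_(size t) => nth set0 t i)).
  apply: uniq_card_le (Vord x).
    rewrite map_inj_in_uniq ?enum_uniq // => i j _ _ /eqP.
    by rewrite nth_uniq ?undup_uniq // => /eqP/val_inj.
  move=> A /mapP[i]; rewrite mem_enum inE => /asboolP Ux ->.
  by split => //; exact: Vt.
Qed.

(** * Line-avoiding maps are open and dense *)

Lemma continuous_sum (R : realType) (T : topologicalType) (J : finType)
    (F : J -> T -> R) :
  (forall j, continuous (F j)) -> continuous (fun x => \sum_j F j x).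
Proof.
move=> Fc x; apply: cvg_big => [|j _]; last exact: Fc.
exact: add_continuous.
Qed.

Lemma continuous_row (R : realType) (T : topologicalType) (N : nat)
    (g : T -> 'rV[R]_N) :
  (forall i, continuous (fun x => g x 0 i)) -> continuous g.
Proof.
move=> gc x A [P Px PA]; rewrite nbhs_simpl /=.
have H : \forall y \near x, forall i, P 0 i (g y 0 i).
  apply: filter_forall => i; exact: gc.
apply: filterS H => y Hy; apply: PA => i j; rewrite (ord1 i); exact: Hy.
Qed.

(** The quantity bounded below is the largest defect of the points [g (x j)] in
    the equations of the line. *)
Definition avoids_lines (R : realType) (X : metricType R) (N : nat)
    (I : {set 'I_N}) (i0 : 'I_N) (q : nat) (eps delta : R) (g : X -> 'rV[R]_N) :
    Prop :=
  forall a d : 'I_N -> R, line_coef I i0 a d ->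
  forall x : 'I_q -> X, (forall j j', j != j' -> ~ ball (x j) eps (x j')) ->
  exists j i, delta <= `|g (x j) 0 i - a i - d i * g (x j) 0 i0|.

Definition line_avoiding (R : realType) (X : metricType R) (N : nat)
    (I : {set 'I_N}) (i0 : 'I_N) (q : nat) (eps : R) :
    set (arrow_uniform_type X 'rV[R]_N) :=
  [set g | exists2 delta, 0 < delta & avoids_lines I i0 q eps delta g].

(** Displacing [g] by at most [delta / 4] changes each defect by at most
    [delta / 2], since [|d i| <= 1]. *)
Lemma open_line_avoiding (R : realType) (X : metricType R) (N : nat)
    (I : {set 'I_N}) (i0 : 'I_N) (q : nat) (eps : R) :
  open (@line_avoiding R X N I i0 q eps).
Proof.
rewrite openE => g [delta delta0 gP]; rewrite /interior -nbhs_ballE.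
have d40 : 0 < delta / 4 by rewrite divr_gt0.
exists (delta / 4) => //= h gh; exists (delta / 2); first by rewrite divr_gt0.
move=> a d had x xsep; have [j [i hij]] := gP a d had x xsep.
exists j, i; have [_ _ d1 _] := had.
have hg k : `|g (x j) 0 k - h (x j) 0 k| <= delta / 4.
  by have [_ /(_ 0 k)] := gh (x j); rewrite -ball_normE /= => /ltW.
have h1 : `|d i * (g (x j) 0 i0 - h (x j) 0 i0)| <= delta / 4.
  by rewrite normrM -[leRHS]mul1r ler_pM.
have : `|g (x j) 0 i - a i - d i * g (x j) 0 i0| <=
    `|h (x j) 0 i - a i - d i * h (x j) 0 i0| + (delta / 4 + delta / 4).
  have -> : g (x j) 0 i - a i - d i * g (x j) 0 i0 =
    (h (x j) 0 i - a i - d i * h (x j) 0 i0) +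
    ((g (x j) 0 i - h (x j) 0 i) - d i * (g (x j) 0 i0 - h (x j) 0 i0)) by ring.
  apply: le_trans (ler_normD _ _) _; apply: lerD => //.
  by apply: le_trans (ler_normB _ _) _; apply: lerD.
move: hij; set s := `|_|; set t := `|_|; lra.
Qed.

(** The map into the nerve of a fine cover, with vertices in general position.
    Points that are [eps]-separated never lie in a common member, so their
    supports are disjoint. *)
Lemma dense_line_avoiding (R : realType) (X : metricType R) (n : nat)
    (I : {set 'I_(n + 2)}) (i0 : 'I_(n + 2)) (eps e : R)
    (f : X -> 'rV[R]_(n + 2)) :
  compact [set: X] -> covering_dim_le X n -> i0 \in I -> 0 < eps ->
  continuous f -> 0 < e ->
  exists g : X -> 'rV[R]_(n + 2),
    [/\ continuous g, line_avoiding I i0 (n + #|I|).+1 eps g &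
        forall x, ball (f x) e (g x)].
Proof.
move=> cX dX i0I eps0 fc e0.
pose e1 := Num.min eps (e / 3); have e30 : 0 < e / 3 by rewrite divr_gt0.
have e10 : 0 < e1 by rewrite lt_min eps0 e30.
have [M [U [Uo Uc Ufine Uord]]] := exists_fine_cover cX dX fc e10.
have /choice[phi phiP] := fun i => continuous_gauge (Uo i).
pose S x := \sum_i phi i x.
have S0 x : 0 < S x.
  have [i Uix] := Uc x; rewrite /S (bigD1 i) //= ltr_pwDl //.
    by have [_ _ /(_ x)[_ ->]] := phiP i.
  by apply: sumr_ge0 => k _; have [_ p0 _] := phiP k; exact: p0.
pose w x u : R := phi u x / S x.
have w0 x u : 0 <= w x u.
  by apply: divr_ge0; [have [_ p0 _] := phiP u; exact: p0 | exact: ltW].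
have w1 x : \sum_u w x u = 1.
  by rewrite -mulr_suml divff // gt_eqF; [|exact: S0].
have wU x u : w x u != 0 -> U u x.
  have [_ p0 pU] := phiP u; rewrite mulf_eq0 negb_or => /andP[p1 _].
  by apply/pU; rewrite lt_neqAle eq_sym p1 p0.
have /choice[z zP] : forall u, exists y : 'rV[R]_(n + 2), forall x, U u x ->
    ball (f x) e1 y.
  move=> u; have [[x0 Ux0]|nU] := pselect (exists x, U u x).
    by exists (f x0) => x Ux; have [] := Ufine u x x0 Ux Ux0.
  by exists 0 => x Ux; case: nU; exists x.
have qE : (n + #|I|).+2 = (n + 2 + #|I|)%N by move: #|_| => c; lia.
have [p [delta [pz delta0 pP]]] :=
  general_position (fun u i => z u 0 i) e30 i0I qE.
pose g x : 'rV[R]_(n + 2) := \row_i \sum_u w x u * p u i.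
exists g; split=> [||x].
- apply: continuous_row => i.
  rewrite (_ : (fun x => _) = (fun x => \sum_u w x u * p u i)); last first.
    by apply/funext => x; rewrite mxE.
  apply: continuous_sum => u x; apply: cvgM; last exact: cvg_cst.
  have [pc _ _] := phiP u; apply: cvgM; first exact: pc.
  apply: cvgV; first by rewrite gt_eqF.
  by apply: continuous_sum => k; have [kc _ _] := phiP k.
- exists delta => // a d had x xsep.
  have [|j [i hij]] := pP (fun j u => w (x j) u) _ a d had; last first.
    by exists j, i; rewrite !mxE.
  split=> [j u|j|j|j j' u jj' wju] //.
    rewrite addn2 /=; apply: leq_trans (Uord (x j)); apply: subset_leq_card.
    by apply/fintype.subsetP => u; rewrite !inE; exact: wU.
  apply/eqP/negPn/negP => wj'u; apply: (xsep j j' jj').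
  have [h _] := Ufine u _ _ (wU _ _ wju) (wU _ _ wj'u).
  by apply: le_ball h; rewrite ge_min lexx.
- split=> // k i; rewrite (ord1 k) -ball_normE /= mxE.
  (* only the vertices of members containing [x] are close to [f x]; the others
     have weight zero *)
pose y u := if `[< U u x >] then p u i - f x 0 i else 0.
  have -> : f x 0 i - \sum_u w x u * p u i = - \sum_u w x u * y u.
    rewrite -[f x 0 i]mul1r -(w1 x) mulr_suml -sumrB -sumrN.
    apply: eq_bigr => u _; rewrite /y; case: asboolP => [_|nU]; first by ring.
    have -> : w x u = 0 by apply/eqP/negPn/negP => /wU.
    by ring.
  rewrite normrN; apply: (@le_lt_trans _ _ (e / 3 + e / 3)); last by lra.
  apply: convex_sum_le => // u; rewrite /y; case: asboolP => [Ux|_]; last first.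
    by rewrite normr0 ltW // addr_gt0.
  rewrite -[p u i](subrK (z u 0 i)) -addrA.
  apply: le_trans (ler_normD _ _) _; apply: lerD; first exact: pz.
  have [_ /(_ 0 i)] := zP u x Ux; rewrite -ball_normE /= distrC => /ltW h.
  by apply: le_trans h _; rewrite ge_min lexx orbT.
Qed.

Lemma coordinate_plane_coord (R : realType) (m : nat) (I : {set 'I_m})
    (v : 'rV[R]_m) (i : 'I_m) :
  v \in coordinate_plane R I -> i \notin I -> v 0 i = 0.
Proof.
move=> vI iI; rewrite (coord_span (X := in_tuple _) vI) summxE big1 // => k _.
have /mapP[i' i'I ->] := mem_nth 0 (ltn_ord k).
rewrite !mxE; have [E|_] := eqVneq i i'; last by rewrite andbF mulr0.
by move: iI; rewrite E -mem_enum i'I.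
Qed.

(** Divide a direction vector by its coordinate of largest absolute value; that
    coordinate belongs to [I] because it does not vanish. *)
Lemma line_normal_form (R : realType) (m : nat) (l : set 'rV[R]_m)
    (I : {set 'I_m}) :
  parallel_to l (coordinate_plane R I) ->
  exists i0 a d, [/\ i0 \in I, line_coef I i0 a d &
    forall y, l y -> forall i, y 0 i - a i - d i * y 0 i0 = 0].
Proof.
move=> [D [D1 [p ->]] DI]; pose u := vpick D.
have u0 : u != 0 by rewrite vpick0 -dimv_eq0 D1.
have Du : D = <[u]>%VS.
  by apply/esym/eqP; rewrite eqEdim -memvE memv_pick D1 dim_vline u0.
have uI i : i \notin I -> u 0 i = 0.
  by apply: coordinate_plane_coord; apply: (subvP DI); exact: memv_pick.
have /rV0Pn[i1 ui1] := u0.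
have [i0 ui0] : exists i0, forall i, `|u 0 i| <= `|u 0 i0|.
  by case: (@arg_maxP _ _ _ i1 xpredT (fun i => `|u 0 i|) isT) => i0 _ H;
     exists i0 => i; exact: H.
have n0 : 0 < `|u 0 i0| by apply: lt_le_trans (ui0 i1); rewrite normr_gt0.
have u00 : u 0 i0 != 0 by rewrite -normr_gt0.
pose d i := u 0 i / u 0 i0.
exists i0, (fun i => p 0 i - d i * p 0 i0), d; split.
- by apply: contraNT u00 => /uI ->.
- split=> [||i|i iI]; rewrite /d ?divff ?mul1r ?subrr //.
    by rewrite normrM normfV ler_pdivrMr // mul1r.
  by rewrite uI // mul0r.
- move=> y; rewrite /affine_subspace /= Du => /vlineP[c yE] i.
  have {}yE k : y 0 k = p 0 k + c * u 0 k.
    by move/rowP: yE => /(_ k); rewrite !mxE => <-; ring.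
  by rewrite !yE /d; field.
Qed.

Lemma separated_points (R : realType) (X : metricType R) (J : finType)
    (x : J -> X) : injective x ->
  exists k : nat, forall j j', j != j' -> ~ ball (x j) k.+1%:R^-1 (x j').
Proof.
move=> xinj; pose c j j' : nat := Num.truncn (mdist (x j) (x j'))^-1.
exists (\sum_j \sum_j' c j j')%N => j j' jj'; rewrite ballEmdist /=.
have d0 : 0 < mdist (x j) (x j') by rewrite mdist_gt0 (inj_eq xinj).
apply/negP; rewrite -leNgt -[leRHS]invrK lef_pV2 ?posrE ?invr_gt0 ?ltr0n //.
apply: ltW; apply: lt_le_trans (truncnS_gt _) _.
rewrite ler_nat ltnS -/(c j j') (bigD1 j) //= (bigD1 j') //= -addnA.
exact: leq_addr.
Qed.

Theorem corollary1p6 (R : realType) (n : nat) (X : metricType R)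
    (X_compact : compact [set: X]) (dimX : covering_dim_le X n) :
  exists G : set (continuousType X 'rV[R]_(n + 2)),
    [/\ Gdelta G, dense G &
        forall g, G g ->
        forall r : nat, (1 <= r <= n + 2)%N ->
        forall l : set 'rV[R]_(n + 2), is_line l ->
        (exists2 P : {vspace 'rV[R]_(n + 2)},
           is_coordinate_plane r P & parallel_to l P) ->
        g @^-1` l #<= `I_(n + r)].
Proof.
(* the conditions are numbered through the encoding of triples by integers;
   numbers that encode nothing impose no condition *)
pose O k : set (arrow_uniform_type X 'rV[R]_(n + 2)) :=
  if (unpickle k : option ({set 'I_(n + 2)} * 'I_(n + 2) * nat)) is
    Some (K, i0, m) then
    if i0 \in K then line_avoiding K i0 (n + #|K|).+1 m.+1%:R^-1 else setT
  else setT.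
have Oopen k : open (O k).
  rewrite /O; case: unpickle => [[[K i0] m]|]; last exact: openT.
  by case: ifP => _; [exact: open_line_avoiding | exact: openT].
pose incl (g : continuousType X 'rV[R]_(n + 2)) :
  arrow_uniform_type X 'rV[R]_(n + 2) := g.
exists (\bigcap_k (incl @^-1` O k)); split.
- exists (fun k => incl @^-1` O k) => // k.
  by exists (O k).
- move=> Q [f Qf] [B Bo BQ].
  have Bf : B (incl f) by rewrite -BQ in Qf.
  have : nbhs (incl f) B by apply: open_nbhs_nbhs; split.
  rewrite -nbhs_ballE => -[e /= e0 eB].
  have complete F : ProperFilter F -> cauchy F ->
      exists l : arrow_uniform_type X 'rV[R]_(n + 2), F --> l.
    by move=> FF Fc; have /cvg_ex := @fun_complete X 'rV[R]_(n + 2) F FF Fc.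
  have closed_cts (u : nat -> arrow_uniform_type X 'rV[R]_(n + 2))
      (l : arrow_uniform_type X 'rV[R]_(n + 2)) :
      (forall k, [set g | continuous (g : X -> _)] (u k)) -> u @ \oo --> l ->
      [set g | continuous (g : X -> _)] l.
    move=> uc ul /=.
    apply: (@uniform_limit_continuous _ _ (u @ \oo)) => [|A /uniform_nbhs[E [entE EA]]].
      by exists 0%N => // k _ /=; exact: uc.
    have /cvg_fct_entourageP/(_ E entE) := ul.
    by apply: filterS => k Ek; apply: EA => y _; exact: Ek.
  have Odense k (g : arrow_uniform_type X 'rV[R]_(n + 2)) (d : R) :
      [set g | continuous (g : X -> _)] g -> 0 < d ->
      exists2 g', [set g | continuous (g : X -> _)] g' /\ O k g' & ball g d g'.
    move=> gc d0; rewrite /O.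
    case: unpickle => [[[K i0] m]|]; last by exists g; [|exact: ballxx].
    case: ifPn => [i0K|_]; last by exists g; [|exact: ballxx].
    have [//|g' [g'c g'a gg']] := @dense_line_avoiding R X n K i0 m.+1%:R^-1 d g
      X_compact dimX i0K _ gc d0.
    by exists g'.
  have [h [hc hO] fh] := baire_relative complete closed_cts Oopen Odense
    (@cts_fun _ _ f) e0.
  exists (mkcts hc); split; last by move=> k _; exact: hO.
  by rewrite -BQ; exact: eB.
- move=> g Gg r _ l _ [_ [I Ir ->]] lI; subst r.
  have [i0 [a [d [i0I had hl]]]] := line_normal_form lI.
  apply: contrapT => /card_gt_points[x [xinj xl]].
  have [m xsep] := separated_points xinj.
  have := Gg (pickle (I, i0, m)) Logic.I; rewrite /O /= pickleK i0I.
  move=> [delta delta0 /(_ a d had x xsep)[j [i]]].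
  by rewrite hl ?normr0 ?leNgt ?delta0 //; exact: xl.

Qed.
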